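(* Assume the Setting and let $(\xi_n,x_n)$ be generated by Algorithm 2 with $0<\mu_0<4\sigma(1-\eta)$ and $0<\beta<1$. Then there exists a solution $x^*$ of $F(x)=y$ with $x^*\in B_{2\rho}(x_0)\cap\mathrm{dom}(\mathcal R)$ such that $\lim_{n\to\infty}D_{\mathcal R}^{\xi_n}(x^*,x_n)=0$ and $\lim_{n\to\infty}\|x_n-x^*\|=0$. If in addition $\mathrm{Ker}(L(x^\dagger))\subset\mathrm{Ker}(L(x))$ for all $x\in B_{2\rho}(x_0)$, then $x^*=x^\dagger$.
   Context: Setting. Let $X,Y$ be real Hilbert spaces. Let $\mathcal R:X\to(-\infty,\infty]$ be proper, lower semicontinuous and strongly convex with constant $\sigma>0$, i.e. $\mathcal R(t\bar x+(1-t)x)+\sigma t(1-t)\|\bar x-x\|^2\le t\mathcal R(\bar x)+(1-t)\mathcal R(x)$ for all $\bar x,x\in\mathrm{dom}(\mathcal R)$ and $t\in[0,1]$. For $\xi\in\partial\mathcal R(x)$ (subdifferential) the Bregman distance is $D_{\mathcal R}^{\xi}(z,x)=\mathcal R(z)-\mathcal R(x)-\langle\xi,z-x\rangle$. The convex conjugate $\mathcal R^*$ is differentiable with $\|\nabla\mathcal R^*(\bar\xi)-\nabla\mathcal R^*(\xi)\|\le\|\bar\xi-\xi\|/(2\sigma)$, and $\nabla\mathcal R^*(\xi)=\arg\min_{x\in X}\{\mathcal R(x)-\langle\xi,x\rangle\}$ (unique minimizer), with $\xi\in\partial\mathcal R(\nabla\mathcal R^*(\xi))$. Let $F:\mathrm{dom}(F)\subset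 X\to Y$ and $y\in Y$. Assume: (b) there are $\rho>0$, $x_0\in X$, $\xi_0\in\partial\mathcal R(x_0)$ with $B_{2\rho}(x_0):=\{x:\|x-x_0\|\le 2\rho\}\subset\mathrm{dom}(F)$, and $F(x)=y$ has a solution $\bar x$ with $D_{\mathcal R}^{\xi_0}(\bar x,x_0)\le\sigma\rho^2$; (c) $F$ is weakly closed: if $x_n\in\mathrm{dom}(F)$, $x_n\rightharpoonup x$ and $F(x_n)\to v$, then $x\in\mathrm{dom}(F)$ and $F(x)=v$; (d) there are bounded linear operators $L(x):X\to Y$, $x\in B_{2\rho}(x_0)$, with $x\mapsto L(x)$ continuous on $B_{2\rho}(x_0)$, a constant $\eta\in[0,1)$ with $\|F(x)-F(\bar x)-L(\bar x)(x-\bar x)\|\le\eta\|F(x)-F(\bar x)\|$ for all $x,\bar x\in B_{2\rho}(x_0)$, and a constant $L>0$ with $\|L(x)\|\le L$ on $B_{2\rho}(x_0)$. Under these assumptions $F(x)=y$ has a unique solution $x^\dagger\in\mathrm{dom}(F)$ minimizing $D_{\mathcal R}^{\xi_0}(x,x_0)$ over all solutions; it satisfies $\|x^\dagger-x_0\|\le\rho$. Algorithm 2 (exact data $y$). Parameters: $\beta\in(0,\infty]$, $\mu_0>0$, $\mu_1>0$, and a fixed choice of step-size rule: (constant) $\alpha_n=\mu_0/L^2$, or (adaptive) $\alpha_n=\min\{\mu_0\|r_n\|^2/\|g_n\|^2,\mu_1\}$ if $r_n\ne0$ and $\alpha_n=0$ if $r_n=0$ (with $\mu_0\|r_n\|^2/\|g_n\|^2:=+\infty$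 if $g_n=0$). Set $\xi_{-1}=\xi_0$, $x_0=\nabla\mathcal R^*(\xi_0)$. For all $n\ge0$ (no stopping): $r_n:=F(x_n)-y$, $g_n:=L(x_n)^*r_n$, $\alpha_n$ by the chosen rule; $m_n:=\xi_n-\xi_{n-1}$; $\tilde\gamma_0:=0$ and for $n\ge1$, $\tilde\gamma_n:=\langle m_n,x_n-x_{n-1}\rangle-(1-\eta)\alpha_{n-1}\|r_{n-1}\|^2+\beta_{n-1}\tilde\gamma_{n-1}$; $\beta_n:=\min\{\max\{0,(\alpha_n\langle g_n,m_n\rangle-2\sigma\tilde\gamma_n)/\|m_n\|^2\},\beta\}$ if $m_n\ne0$ and $\beta_n:=0$ if $m_n=0$; $\xi_{n+1}:=\xi_n-\alpha_ng_n+\beta_nm_n$, $x_{n+1}:=\nabla\mathcal R^*(\xi_{n+1})$. *)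

(* Defs.v *)
From HB Require Import structures.
From mathcomp Require Import all_boot all_order all_algebra.
From mathcomp Require Import all_classical all_reals all_analysis.
Set Implicit Arguments. Unset Strict Implicit. Unset Printing Implicit Defensive.
Import Order.TTheory GRing.Theory Num.Theory.
Import numFieldNormedType.Exports.
Local Open Scope classical_set_scope.
Local Open Scope ring_scope.

(* A real inner product on a normed space V whose norm is induced by it.
   A real Hilbert space is then a complete normed module V over R together
   with such an inner product. *)
Record inner_product (R : realType) (V : normedModType R) := InnerProduct {
  ip :> V -> V -> R;
  ip_sym : forall u v, ip u v = ip v u;
  ip_linear : forall (a : R) u v w, ip (a *: u + v) w = a * ip u w + ip v w;
  ip_norm : forall u, ip u u = `|u| ^+ 2
}.

Definition weak_cvg (R : realType) (V : normedModType R) (ipV : inner_product V)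
  (u : nat -> V) (x : V) : Prop :=
  forall v : V, (fun n => ipV v (u n)) @ \oo --> ipV v x.

Definition cball (R : realType) (V : normedModType R) (c : V) (r : R) : set V :=
  [set x | `|x - c| <= r].

Section Convex.
Local Open Scope ereal_scope.
Context (R : realType) (X : normedModType R) (ipX : inner_product X).

Definition edom (Rf : X -> \bar R) : set X := [set x | Rf x < +oo].

Definition proper_fun (Rf : X -> \bar R) : Prop :=
  (exists x, Rf x < +oo) /\ (forall x, -oo < Rf x).

Definition strongly_convex (Rf : X -> \bar R) (sigma : R) : Prop :=
  forall xb x : X, edom Rf xb -> edom Rf x -> forall t : R, (0 <= t <= 1)%R ->
    Rf (t *: xb + (1 - t) *: x)%R + (sigma * t * (1 - t) * `|(xb - x)%R| ^+ 2)%:E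
      <= t%:E * Rf xb + (1 - t)%:E * Rf x.

Definition subdiff (Rf : X -> \bar R) (x xi : X) : Prop :=
  edom Rf x /\ forall z, Rf x + (ipX xi (z - x)%R)%:E <= Rf z.

Definition bregman (Rf : X -> \bar R) (xi z x : X) : \bar R :=
  Rf z - Rf x - (ipX xi (z - x)%R)%:E.
End Convex.

(* Algorithm 2 (exact data), written as the recurrence relations that
   determine the sequences uniquely.  Indices: m n = xi_n - xi_{n-1} with
   xi_{-1} = xi_0 (so m 0 = 0).  [adaptive = false] : constant step size
   alpha_n = mu0 / Lc^2; [adaptive = true] : the adaptive rule. *)
Definition Algorithm2 (R : realType) (X Y : normedModType R)
  (ipX : inner_product X) (ipY : inner_product Y)
  (F : X -> Y) (y : Y) (Ladj : X -> Y -> X) (gradRs : X -> X)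
  (eta Lc beta mu0 mu1 sigma : R) (adaptive : bool) (xi0 : X)
  (xi x : nat -> X) (alpha betan gamma : nat -> R) : Prop :=
  let r n := F (x n) - y in
  let g n := Ladj (x n) (r n) in
  let m n := match n with 0%N => 0 | k.+1 => xi k.+1 - xi k end in
  [/\ xi 0%N = xi0 /\ (forall n, x n = gradRs (xi n)),
      forall n, alpha n =
        (if adaptive then
           (if r n == 0 then 0
            else if g n == 0 then mu1
            else Num.min (mu0 * `|r n| ^+ 2 / `|g n| ^+ 2) mu1)
         else mu0 / Lc ^+ 2),
      gamma 0%N = 0 /\
      (forall n, gamma n.+1 = ipX (m n.+1) (x n.+1 - x n)
                 - (1 - eta) * alpha n * `|r n| ^+ 2 + betan n * gamma n),
      forall n, betan n =
        (if m n == 0 then 0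
         else Num.min (Num.max 0 ((alpha n * ipX (g n) (m n)
                                   - 2 * sigma * gamma n) / `|m n| ^+ 2)) beta)
    & forall n, xi n.+1 = xi n - alpha n *: g n + betan n *: m n].

(* Main.v *)
(* For every solution z the Bregman distance D^{xi_n}(z, x_n) decreases by at
   least a multiple of alpha_n |F x_n - y|^2: gamma_n bounds <m_n, x_n - z>, and
   beta_n lies between 0 and the minimiser of the resulting quadratic upper
   bound in beta, whose value at 0 is 0.  Hence the squared residuals are
   summable, and so are the discounted sums
   w_n = sum_(i <= n) beta^(n-i) |F x_i - y|^2 + beta^n.
   If w_q is minimal among w_0, ..., w_q, the tangential cone condition gives
   |<m_(n+1), x_q - z>| <= C w_n for n <= q, hence for p <= q
     D^{xi_p}(x_q, x_p) <= D^{xi_p}(z, x_p) - D^{xi_q}(z, x_q) + C sum_(p <= n < q) w_n.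
   So the iterates at such indices q form a Cauchy sequence; its limit x* is a
   solution, and lower semicontinuity gives D^{xi_p}(x*, x_p) -> 0 for all p.
   Under the kernel condition every xi_n - xi_0 is orthogonal to x* - xdag, so
   D^{xi_n}(xdag, x_n) <= D^{xi_n}(x*, x_n), and x_n tends to xdag as well. *)

Require Import Defs.
From HB Require Import structures.
From mathcomp Require Import all_boot all_order all_algebra.
From mathcomp Require Import all_classical all_reals all_analysis.
From mathcomp Require Import ring lra.
Import Order.TTheory GRing.Theory Num.Theory.
Import numFieldNormedType.Exports.
Local Open Scope classical_set_scope.
Local Open Scope ring_scope.

Set Implicit Arguments. Unset Strict Implicit. Unset Printing Implicit Defensive.

(** * Inner product calculus *)

Section InnerProduct.
Context {R : realType} {V : normedModType R} (dot : inner_product V).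

Lemma ipDl u v w : dot (u + v) w = dot u w + dot v w.
Proof. by have := ip_linear dot 1 u v w; rewrite scale1r mul1r. Qed.

Lemma ip0l w : dot 0 w = 0.
Proof. by apply: (addrI (dot 0 w)); rewrite -ipDl !addr0. Qed.

Lemma ipZl a u w : dot (a *: u) w = a * dot u w.
Proof. by have := ip_linear dot a u 0 w; rewrite addr0 ip0l addr0. Qed.

Lemma ipNl u w : dot (- u) w = - dot u w.
Proof. by rewrite -scaleN1r ipZl mulN1r. Qed.

Lemma ipBl u v w : dot (u - v) w = dot u w - dot v w.
Proof. by rewrite ipDl ipNl. Qed.

Lemma ipDr u v w : dot w (u + v) = dot w u + dot w v.
Proof. by rewrite !(ip_sym dot w) ipDl. Qed.

Lemma ipZr a u w : dot w (a *: u) = a * dot w u.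
Proof. by rewrite !(ip_sym dot w) ipZl. Qed.

Lemma ipNr u w : dot w (- u) = - dot w u.
Proof. by rewrite !(ip_sym dot w) ipNl. Qed.

Lemma ipBr u v w : dot w (u - v) = dot w u - dot w v.
Proof. by rewrite ipDr ipNr. Qed.

Lemma ip0r w : dot w 0 = 0.
Proof. by rewrite ip_sym ip0l. Qed.

Definition ipE := (ipDl, ipDr, ipNl, ipNr, ipZl, ipZr, ip0l, ip0r).

(** The squared norm of |v| u + s |u| v is nonnegative; s = 1 and s = -1 give the two signs. *)
Lemma ip_cauchy_schwarz u v : `|dot u v| <= `|u| * `|v|.
Proof.
have [->|u0] := eqVneq u 0; first by rewrite ip0l !normr0 mul0r.
have [->|v0] := eqVneq v 0; first by rewrite ip0r !normr0 mulr0.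
have uv : 0 < `|u| * `|v| by rewrite mulr_gt0 // normr_gt0.
have expand (s : R) : s ^+ 2 = 1 -> - s * dot u v <= `|u| * `|v|.
  move=> s1; rewrite -(ler_pM2l uv).
  have : 0 <= `|(`|v| *: u + (s * `|u|) *: v)| ^+ 2 by exact: exprn_ge0.
  rewrite -(ip_norm dot) !ipE (ip_sym dot v u) !ip_norm; nra.
rewrite ler_norml; apply/andP; split.
  by have := expand 1 (expr1n _ _); lra.
by have := expand (-1) ltac:(ring); lra.
Qed.

Lemma ip_cauchy_schwarz_le u v : dot u v <= `|u| * `|v|.
Proof. exact: le_trans (ler_norm _) (ip_cauchy_schwarz u v). Qed.

(** Beyond Cauchy-Schwarz, the slack is the square (|u| - 2 s |v|)^2 / (4 s). *)
Lemma ip_le_young (s : R) (u v : V) : 0 < s ->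
  dot u v <= `|u| ^+ 2 / (4 * s) + s * `|v| ^+ 2.
Proof.
move=> s0; apply: le_trans (ip_cauchy_schwarz_le _ _) _.
rewrite -subr_ge0 (_ : _ - _ = (`|u| - 2 * s * `|v|) ^+ 2 / (4 * s)).
  by rewrite divr_ge0 ?sqr_ge0 // ltW // mulr_gt0.
by field; rewrite gt_eqF.
Qed.

Lemma cvg_ipr (u : nat -> V) (z v : V) :
  u @ \oo --> z -> (fun n => dot v (u n)) @ \oo --> dot v z.
Proof.
move=> uz; apply/cvgrPdist_lt => e e0.
have v1 : 0 < `|v| + 1 by rewrite ltr_wpDl.
move/cvgrPdist_lt : uz => /(_ (e / (`|v| + 1)) (divr_gt0 e0 v1)).
apply: filterS => n; rewrite ltr_pdivlMr // => h.
rewrite -ipBr (le_lt_trans (ip_cauchy_schwarz _ _)) //.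
by apply: le_lt_trans h; rewrite mulrC ler_wpM2l // lerDl.
Qed.

End InnerProduct.

(** * Monotone real sequences and record lows *)

Section RealSequences.
Context {R : realType}.
Implicit Types (w V : nat -> R).

(** Every V q is at least the limit, so p and q need no order. *)
Lemma nonincreasing_ge0_cauchy V (e : R) :
  (forall n, V n.+1 <= V n) -> (forall n, 0 <= V n) -> 0 < e ->
  exists N, forall p q, (N <= p)%N -> V p - V q <= e.
Proof.
move=> dV V0 e0.
have lbV : has_lbound (range V) by exists 0 => _ [n _ <-].
have niV : nonincreasing_seq V by exact/nonincreasing_seqP.
have cV : cvgn V by exact: nonincreasing_is_cvgn.
have /cvgrPdist_le /(_ e e0) [N _ NV] := cV.
exists N => p q Np.
have := NV p Np; have := nonincreasing_cvgn_ge niV cV q.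
have := nonincreasing_cvgn_ge niV cV p.
by rewrite ler_norml => ? ? /andP[]; lra.
Qed.

Definition record_low w : set nat := [set n | forall i, (i <= n)%N -> w n <= w i].

(** If d > 0 bounds w_0, ..., w_N from below, the first index with value below d lies beyond N and
    is a record low. *)
Lemma record_low_unbounded w : (forall n, 0 < w n) -> w @ \oo --> (0 : R) ->
  forall N, exists2 n, (N <= n)%N & record_low w n.
Proof.
move=> w0 cw N.
have [d d0 dw] : exists2 d, 0 < d & forall i, (i <= N)%N -> d <= w i.
  elim: N => [|N [d d0 dw]]; first by exists (w 0%N) => // -[].
  exists (Num.min d (w N.+1)); first by rewrite lt_min d0 w0.
  move=> i; rewrite leq_eqVlt => /predU1P[->|/dw di]; first by rewrite ge_min lexx orbT.
  by rewrite ge_min di.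
have ex_lt : exists n, w n < d.
  have [M _ Mw] := (cvgrPdist_lt _ _).1 cw d d0.
  exists M; rewrite (le_lt_trans (ler_norm _)) //.
  by have := Mw M (leqnn _); rewrite sub0r normrN.
case: (ex_minnP ex_lt) => n wn nmin; exists n.
  by rewrite leqNgt; apply/negP => /ltnW /dw; rewrite leNgt wn.
move=> i; rewrite leq_eqVlt => /predU1P[->//|i_lt_n].
apply/ltW/(lt_le_trans wn); rewrite leNgt; apply/negP => /nmin.
by rewrite leqNgt i_lt_n.
Qed.
End RealSequences.

Lemma lower_semicontinuous_le_cvg {R : realType} {T : topologicalType}
    (f : T -> \bar R) (u : nat -> T) (z : T) (b : nat -> R) (c : R) :
  lower_semicontinuous f -> u @ \oo --> z -> b @ \oo --> c ->
  (\forall n \near \oo, (f (u n) <= (b n)%:E)%E) -> (f z <= c%:E)%E.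
Proof.
move=> lscf uz bc fub; rewrite leNgt; apply/negP => cf.
(* A real strictly between c and f z, available also when f z = +oo, ends up above b n and below f
   (u n). *)
have [a ca af] : exists2 a : R, c < a & (a%:E < f z)%E.
  case: (f z) cf => [s| |]//.
    rewrite lte_fin => cs; exists ((c + s) / 2); rewrite ?lte_fin; lra.
  by move=> _; exists (c + 1); rewrite ?ltry //; lra.
have [W zW Wf] := lscf z a af.
have near_b : \forall n \near \oo, b n < a by exact: cvgr_lt bc a ca.
have near_u : \forall n \near \oo, W (u n) by exact: uz.
near \oo => n.
suff : (a%:E < a%:E)%E by rewrite ltxx.
have /Wf/lt_le_trans-> // : W (u n) by near: n.
apply: (@le_trans _ _ (b n)%:E); first by near: n.
by rewrite lee_fin; apply/ltW; near: n.
Unshelve. all: by end_near. Qed.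

(** * Bregman distances under strong convexity *)

Section Bregman.
Context {R : realType} {X : normedModType R} (dot : inner_product X).
Context (Rf : X -> \bar R) (Rf_proper : proper_fun Rf).

(** Real-valued, so that linear arithmetic applies; meaningful only on the effective domain, since
    [fine] sends +oo to 0. *)
Definition bregr (v z x : X) : R := fine (Rf z) - fine (Rf x) - dot v (z - x).

Lemma edom_fineK z : edom Rf z -> (fine (Rf z))%:E = Rf z.
Proof.
by move=> zD; rewrite fineK // fin_numElt zD andbT; exact: Rf_proper.2.
Qed.

Lemma bregmanE v z x : edom Rf z -> edom Rf x ->
  bregman dot Rf v z x = (bregr v z x)%:E.
Proof. by move=> zD xD; rewrite /bregman -(edom_fineK zD) -(edom_fineK xD). Qed.

Lemma bregman_fin_edom v z x (c : R) : edom Rf x ->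
  (bregman dot Rf v z x <= c%:E)%E -> edom Rf z.
Proof.
move=> xD; rewrite /bregman -(edom_fineK xD) /edom /=.
by case: Rf_proper => _ /(_ z); case: (Rf z).
Qed.

Lemma subdiff_bregr_ge0 v z x : subdiff dot Rf x v -> edom Rf z -> 0 <= bregr v z x.
Proof.
move=> [xD /(_ z)] + zD.
rewrite -(edom_fineK zD) -(edom_fineK xD) -EFinD lee_fin /bregr; lra.
Qed.

(** Serves consecutive iterates in the descent and iterates p, q in the Cauchy estimate. *)
Lemma bregr_three_points v v' z x x' :
  bregr v' z x' = bregr v z x + bregr v' x x' + dot (v' - v) (x - z).
Proof. rewrite /bregr ipBl !ipBr; ring. Qed.

Lemma bregr_sym v v' x x' : bregr v' x x' + bregr v x' x = dot (v' - v) (x' - x).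
Proof. rewrite /bregr ipBl !ipBr; ring. Qed.

Context (sigma : R) (sigma_gt0 : 0 < sigma) (Rf_sc : strongly_convex Rf sigma).

(** The subgradient inequality at w = t z + (1 - t) x and strong convexity, divided by t, give the
    bound up to the factor 1 - t; then t tends to 0. *)
Lemma subdiff_bregr_ge v z x : subdiff dot Rf x v -> edom Rf z ->
  sigma * `|z - x| ^+ 2 <= bregr v z x.
Proof.
move=> vx zD; have xD := vx.1.
have s0 : 0 <= sigma * `|z - x| ^+ 2 by rewrite mulr_ge0 // ltW.
have seg (t : R) : 0 < t <= 1 -> (1 - t) * (sigma * `|z - x| ^+ 2) <= bregr v z x.
  move=> /andP[t0 t1]; rewrite -(ler_pM2l t0).
  have t01 : 0 <= t <= 1 by rewrite t1 ltW.
  have := Rf_sc zD xD t01; set w := t *: z + (1 - t) *: x.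
  have wx : w - x = t *: (z - x).
    by rewrite /w scalerBl scale1r scalerBr addrA addrAC addrK.
  move=> scw.
  have wD : edom Rf w.
    move: scw; rewrite -(edom_fineK zD) -(edom_fineK xD) /edom /=.
    by case: (Rf w) => [s _| |_]; rewrite ?ltry ?ltNy0.
  have := subdiff_bregr_ge0 vx wD; rewrite /bregr wx ipZr.
  move: scw; rewrite -(edom_fineK wD) -(edom_fineK zD) -(edom_fineK xD).
  rewrite -!EFinM -!EFinD lee_fin; nra.
apply/ler_addgt0Pr => e e0.
set s := sigma * _ in s0 seg *.
(* This t in (0, 1] makes the loss t s at most e. *)
pose t := e / (e + s).
have es : 0 < e + s by rewrite ltr_wpDr.
have t01 : 0 < t <= 1 by rewrite divr_gt0 //= ler_pdivrMr // mul1r lerDl.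
have : t * s <= e by rewrite /t mulrAC ler_pdivrMr // ler_pM2l // lerDr ltW.
have := seg t t01; lra.
Qed.

(** Young's inequality with parameter sigma, applied to the symmetrised sum <v' - v, x' - x>,
    produces sigma |x' - x|^2, which the other Bregman distance absorbs. *)
Lemma bregr_le_dual v v' x x' : subdiff dot Rf x v -> subdiff dot Rf x' v' ->
  bregr v' x x' <= `|v' - v| ^+ 2 / (4 * sigma).
Proof.
move=> vx vx'; have := subdiff_bregr_ge vx vx'.1.
by have := bregr_sym v v' x x'; have := ip_le_young dot (v' - v) (x' - x) sigma_gt0; lra.
Qed.

Lemma argmin_subdiff v x :
  (forall z, (Rf x - (dot v x)%:E <= Rf z - (dot v z)%:E)%E) -> subdiff dot Rf x v.
Proof.
move=> argmin.
have xD : edom Rf x.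
  have [[z zD] _] := Rf_proper; move: (argmin z); rewrite -(edom_fineK zD) /edom /=.
  by case: (Rf x) => [s _| |_]; rewrite ?ltry ?ltNy0.
split=> // z; move: (argmin z); rewrite -(edom_fineK xD).
case: Rf_proper => _ /(_ z); case: (Rf z) => [s _| |].
  rewrite -!EFinD !lee_fin ipBr; lra.
  by move=> _ _; rewrite leey.
by rewrite ltxx.
Qed.

(** The two mutual distances sum to <v - v, x' - x> = 0, and each is at least sigma |x - x'|^2. *)
Lemma subdiff_inj v x x' : subdiff dot Rf x v -> subdiff dot Rf x' v -> x = x'.
Proof.
move=> vx vx'.
have := subdiff_bregr_ge vx vx'.1; have := subdiff_bregr_ge vx' vx.1.
have := bregr_sym v v x x'; rewrite subrr ip0l (distrC x' x) => h1 h2 h3.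
apply/eqP; rewrite -subr_eq0 -normr_eq0 -(sqrf_eq0 `|x - x'|); apply/eqP/le_anti.
rewrite exprn_ge0 // andbT -(ler_pM2l sigma_gt0); lra.
Qed.

End Bregman.

(** * Step sizes, clipped momentum weights, discounted sums *)

Section StepRules.
Context {R : realType}.

(** Treats both rules at once. The last bound carries the factor |r|^2 because the adaptive step is
    0 when r = 0. *)
Lemma stepsize_bounds {U V : normedModType R} (r : U) (g : V)
    (Lc mu0 mu1 a : R) (adaptive : bool) :
  0 < Lc -> 0 < mu0 -> 0 < mu1 -> `|g| <= Lc * `|r| ->
  a = (if adaptive then
         (if r == 0 then 0
          else if g == 0 then mu1
          else Num.min (mu0 * `|r| ^+ 2 / `|g| ^+ 2) mu1)
       else mu0 / Lc ^+ 2) ->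
  [/\ 0 <= a <= mu0 / Lc ^+ 2 + mu1, a * `|g| ^+ 2 <= mu0 * `|r| ^+ 2
    & Num.min (mu0 / Lc ^+ 2) mu1 * `|r| ^+ 2 <= a * `|r| ^+ 2].
Proof.
move=> Lc0 mu00 mu10 gr ->.
have q0 : 0 < mu0 / Lc ^+ 2 by rewrite divr_gt0 // exprn_gt0.
have rr : 0 <= `|r| ^+ 2 by rewrite exprn_ge0.
have gr2 : `|g| ^+ 2 <= Lc ^+ 2 * `|r| ^+ 2.
  by rewrite -exprMn ler_pXn2r ?nnegrE // (le_trans _ gr).
have q_min : Num.min (mu0 / Lc ^+ 2) mu1 <= mu0 / Lc ^+ 2 by rewrite ge_min lexx.
have mu1_min : Num.min (mu0 / Lc ^+ 2) mu1 <= mu1 by rewrite ge_min lexx orbT.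
case: adaptive; last first.
  split; [by apply/andP; lra| |exact: ler_wpM2r].
  apply: le_trans (ler_wpM2l (ltW q0) gr2) _.
  by rewrite mulrA divfK // sqrf_eq0 gt_eqF.
have [->|r0] := eqVneq r 0.
  rewrite mul0r normr0 expr0n /= !mulr0 lexx; split=> //; apply/andP; lra.
have [->|g0] := eqVneq g 0.
  rewrite normr0; split; [by apply/andP; lra|rewrite expr0n /= mulr0|exact: ler_wpM2r].
  by rewrite mulr_ge0 // ltW.
have g20 : 0 < `|g| ^+ 2 by rewrite exprn_gt0 // normr_gt0.
have r20 : 0 < `|r| ^+ 2 by rewrite exprn_gt0 // normr_gt0.
have t0 : 0 < mu0 * `|r| ^+ 2 / `|g| ^+ 2 by rewrite divr_gt0 // mulr_gt0.
set t := _ / _ in t0 *.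
split.
- rewrite le_min (ltW t0) (ltW mu10) /= ge_min; apply/orP; right; lra.
- rewrite -ler_pdivlMr // -/t.
  by rewrite ge_min lexx.
- apply: ler_wpM2r => //.
  rewrite le_min mu1_min andbT; apply: le_trans q_min _.
  (* From |g| <= Lc |r|, the quotient t is at least mu0 / Lc^2. *)
  rewrite /t ler_pdivlMr // mulrAC ler_pdivrMr ?exprn_gt0 //.
  by rewrite -mulrA ler_pM2l // mulrC.
Qed.

(** For m nonzero, clipping gives b = 0 when c <= 0 and b |m|^2 <= c otherwise. *)
Lemma clipped_momentum {U : normedModType R} (m : U) (c beta b : R) : 0 < beta ->
  b = (if m == 0 then 0
       else Num.min (Num.max 0 (c / `|m| ^+ 2)) beta) ->
  0 <= b <= beta /\ b ^+ 2 * `|m| ^+ 2 <= b * c.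
Proof.
move=> beta0 ->; have [->|m0] := eqVneq m 0.
  by rewrite lexx ltW // normr0 !expr0n /= !mul0r.
have m20 : 0 < `|m| ^+ 2 by rewrite exprn_gt0 // normr_gt0.
have [c0|c0] := leP c 0.
  have -> : Num.max 0 (c / `|m| ^+ 2) = 0.
    by apply/max_idPl; rewrite pmulr_lle0 ?invr_gt0.
  by rewrite (min_idPl (ltW beta0)) lexx ltW // expr0n /= !mul0r.
have -> : Num.max 0 (c / `|m| ^+ 2) = c / `|m| ^+ 2.
  by apply/max_idPr; rewrite divr_ge0 // ltW.
set b' := Num.min _ _.
have b0 : 0 <= b' by rewrite le_min divr_ge0 ?ltW.
split; first by rewrite b0 ge_min lexx orbT.
rewrite expr2 -mulrA ler_wpM2l // -ler_pdivlMr //.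
by rewrite ge_min lexx.
Qed.

(** Unrolling the recursion gives a discounted sum of s, at most w, plus a geometric series in d,
    absorbed through d <= w n. *)
Lemma discounted_bound (a w s : nat -> R) (be k d C : R) (q : nat) :
  0 <= be < 1 -> 0 <= C -> 0 <= d ->
  a 0%N = 0 -> s 0%N <= w 0%N -> (forall n, w n.+1 = s n.+1 + be * w n) ->
  (forall n, (n <= q)%N -> d <= w n) ->
  (forall n, (n <= q)%N -> a n.+1 <= C * (k * s n + d) + be * a n) -> 0 <= k ->
  forall n, (n <= q)%N -> a n.+1 <= C * (k + (1 - be)^-1) * w n.
Proof.
move=> /andP[be0 be1] C0 d0 a0 w0 wS dw aS k0.
have be1' : 0 < 1 - be by lra.
(* Sum of the geometric series, that is, the fixed point of e = d + be e. *)
pose e := d / (1 - be).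
have e0 : 0 <= e by rewrite divr_ge0 // ltW.
have ed : e * (1 - be) = d by rewrite divfK // gt_eqF.
have aw n : (n <= q)%N -> a n.+1 <= C * (k * w n + e).
  elim: n => [|n IH] nq.
    apply: le_trans (aS _ nq) _; rewrite a0 mulr0 addr0 ler_wpM2l // lerD ?ler_wpM2l //.
    by rewrite -ed; nra.
  apply: le_trans (aS _ nq) _; rewrite wS.
  by have := ler_wpM2l be0 (IH (ltnW nq)); rewrite -ed; nra.
move=> n nq; apply: le_trans (aw n nq) _; rewrite -mulrA ler_wpM2l // mulrDl lerD2l.
by rewrite mulrC ler_wpM2r ?invr_ge0 ?(ltW be1') // dw.
Qed.

End StepRules.

(** * Descent of the Bregman distance along the iteration *)

Section Iteration.
Context {R : realType} {X : completeNormedModType R} {Y : normedModType R}.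
Context (ipX : inner_product X) (ipY : inner_product Y).
Context (Rf : X -> \bar R) (sigma : R) (F : X -> Y) (y : Y).
Context (Lop : X -> X -> Y) (Ladj : X -> Y -> X) (gradRs : X -> X) (B : set X).
Context (xi0 : X) (eta Lc beta mu0 mu1 : R) (adaptive : bool).
Context (xi x : nat -> X) (alpha betan gamma : nat -> R).

Context (Rf_proper : proper_fun Rf) (sigma_gt0 : 0 < sigma).
Context (Rf_sc : strongly_convex Rf sigma).
Context (gradRs_argmin : forall v z : X,
  (Rf (gradRs v) - (ipX v (gradRs v))%:E <= Rf z - (ipX v z)%:E)%E).
Context (LopK : forall z, B z -> forall h r, ipY (Lop z h) r = ipX h (Ladj z r)).
Context (eta01 : 0 <= eta < 1).
Context (tcc : forall z zb, B z -> B zb ->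
  `|F z - F zb - Lop zb (z - zb)| <= eta * `|F z - F zb|).
Context (Lc_gt0 : 0 < Lc).
Context (Lop_le : forall z, B z -> forall h, `|Lop z h| <= Lc * `|h|).
Context (mu0_bnd : 0 < mu0 < 4 * sigma * (1 - eta)) (beta01 : 0 < beta < 1).
Context (mu1_gt0 : 0 < mu1).
Context (alg : Algorithm2 ipX ipY F y Ladj gradRs eta Lc beta mu0 mu1 sigma
  adaptive xi0 xi x alpha betan gamma).

Let r n := F (x n) - y.
Let g n := Ladj (x n) (r n).
Let m n := match n with 0%N => 0 | k.+1 => xi k.+1 - xi k end.

Let solution z := [/\ B z, edom Rf z & F z = y].

Lemma iterate_subdiff n : subdiff ipX Rf (x n) (xi n).
Proof.
by have [[_ xE] _ _ _ _] := alg; rewrite xE; exact: argmin_subdiff.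
Qed.

Lemma momentumS n : m n.+1 = - (alpha n *: g n) + betan n *: m n.
Proof. by have [_ _ _ _ xiS] := alg; apply/eqP; rewrite /= subr_eq xiS -addrA addrC. Qed.

(** Take h = [Ladj z u] in the adjoint identity. *)
Lemma adjoint_le z u : B z -> `|Ladj z u| <= Lc * `|u|.
Proof.
move=> Bz; have [->|Ln0] := eqVneq (Ladj z u) 0.
  by rewrite normr0 mulr_ge0 // ltW.
rewrite -(@ler_pM2l _ `|Ladj z u|) ?normr_gt0 // -expr2 -(ip_norm ipX) -LopK //.
apply: le_trans (ip_cauchy_schwarz_le _ _ _) _.
by rewrite mulrCA mulrA ler_wpM2r // Lop_le.
Qed.

Lemma stepsize_iterate n : B (x n) ->
  [/\ 0 <= alpha n <= mu0 / Lc ^+ 2 + mu1,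
      alpha n * `|g n| ^+ 2 <= mu0 * `|r n| ^+ 2
    & Num.min (mu0 / Lc ^+ 2) mu1 * `|r n| ^+ 2 <= alpha n * `|r n| ^+ 2].
Proof.
move=> Bn; have [_ alphaE _ _ _] := alg.
apply: stepsize_bounds (alphaE n) => //; last exact: adjoint_le.
by case/andP: mu0_bnd.
Qed.

Lemma momentum_weight n : 0 <= betan n <= beta /\
  betan n ^+ 2 * `|m n| ^+ 2 <=
    betan n * (alpha n * ipX (g n) (m n) - 2 * sigma * gamma n).
Proof.
have [_ _ _ betaE _] := alg.
by apply: clipped_momentum (betaE n); case/andP: beta01.
Qed.

(** The cone condition for z and x_n, where F z - F x_n = - r_n, is paired with r_n and moved to X
    by the adjoint. *)
Lemma residual_monotone z n : solution z -> B (x n) ->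
  (1 - eta) * `|r n| ^+ 2 <= ipX (g n) (x n - z).
Proof.
move=> [Bz _ Fz] Bn; have := tcc Bz Bn.
have -> : F z - F (x n) = - r n by rewrite Fz opprB.
rewrite normrN => h.
have := le_trans (ip_cauchy_schwarz ipY (- r n - Lop (x n) (z - x n)) (r n))
  (ler_wpM2r (normr_ge0 (r n)) h).
rewrite ipBl ipNl ip_norm LopK // -/(g n) => {}h.
rewrite -(opprB z) ipNr (ip_sym _ (g n)).
by move: h; rewrite ler_norml => /andP[]; lra.
Qed.

(** The algorithm computes gamma without knowing z: of x_(n+1) - z it keeps the increment x_(n+1) -
    x_n exactly, while [residual_monotone] and induction bound the rest. *)
Lemma gamma_ge n z : solution z -> (forall i, (i < n)%N -> B (x i)) ->
  ipX (m n) (x n - z) <= gamma n.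
Proof.
move=> zs; have [_ _ [gamma0 gammaS] _ _] := alg.
elim: n => [|n IH] Bi; first by rewrite ip0l gamma0.
have -> : ipX (m n.+1) (x n.+1 - z) =
    ipX (m n.+1) (x n.+1 - x n) + ipX (m n.+1) (x n - z).
  by rewrite -ipDr addrA subrK.
rewrite gammaS -[leRHS]addrA lerD2l.
rewrite -/(m n.+1) momentumS ipDl ipNl !ipZl -/(r n).
have Bn := Bi n (ltnSn n).
have [/andP[a0 _] _ _] := stepsize_iterate Bn; have [/andP[b0 _] _] := momentum_weight n.
have := ler_wpM2l a0 (residual_monotone zs Bn).
have := ler_wpM2l b0 (IH (fun i lt_in => Bi i (ltnW lt_in))).
lra.
Qed.

Let D z n := bregr ipX Rf (xi n) z (x n).
(** Positive exactly when mu0 < 4 sigma (1 - eta). *)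
Let c := 1 - eta - mu0 / (4 * sigma).

Lemma descent_const_gt0 : 0 < c.
Proof.
by rewrite subr_gt0 ltr_pdivrMr ?mulr_gt0 // mulrC; case/andP: mu0_bnd.
Qed.

(** The three-point identity and [bregr_le_dual] bound the increment by |m_(n+1)|^2 / (4 sigma) +
    <m_(n+1), x_n - z>. After expansion, the terms containing [betan n] total at most 0 by
    [momentum_weight], and alpha^2 |g|^2 <= mu0 alpha |r|^2 leaves the factor c. The ball is assumed
    only up to n, which suits the induction in [iterate_ball]. *)
Lemma descent n z : solution z -> (forall i, (i <= n)%N -> B (x i)) ->
  D z n.+1 <= D z n - c * (alpha n * `|r n| ^+ 2).
Proof.
move=> zs Bi; have Bn := Bi n (leqnn n).
rewrite /D (bregr_three_points ipX Rf (xi n) (xi n.+1) z (x n)) -/(m n.+1).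
have := bregr_le_dual Rf_proper sigma_gt0 Rf_sc (iterate_subdiff n) (iterate_subdiff n.+1).
have [/andP[a0 _] ag _] := stepsize_iterate Bn; have [/andP[b0 _] bm] := momentum_weight n.
have s4 : 0 < 4 * sigma by rewrite mulr_gt0.
have := ler_wpM2l (ltW s4) (ler_wpM2l a0 (residual_monotone zs Bn)).
have := ler_wpM2l (ltW s4) (ler_wpM2l b0 (gamma_ge zs (fun i lt_in => Bi i (ltnW lt_in)))).
have bm0 : 0 <= betan n ^+ 2 * `|m n| ^+ 2 by rewrite mulr_ge0 ?exprn_ge0.
rewrite -/(m n.+1) momentumS -(ip_norm ipX (_ + _)) !ipE !ip_norm (ip_sym _ (m n) (g n)).
set T := bregr _ _ _ (x n) _; rewrite ler_pdivlMr // => hgamma hres hT.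
rewrite -(ler_pM2l s4).
have cE : 4 * sigma * c = 4 * sigma * (1 - eta) - mu0.
  by rewrite /c; field; rewrite gt_eqF.
rewrite mulrBr (mulrA _ c) cE.
have := ler_wpM2l a0 ag.
lra.
Qed.

(** * Invariance of the ball and summability of residuals *)

Context (rho : R) (x0 xb : X).
Context (ball_B : B = cball x0 (2 * rho)) (rho_gt0 : 0 < rho).
Context (x0_subdiff : subdiff ipX Rf x0 xi0).
Context (xb_sol : F xb = y) (xb_edom : edom Rf xb).
Context (xb_near : bregr ipX Rf xi0 xb x0 <= sigma * rho ^+ 2).

Lemma iterate0 : x 0%N = x0.
Proof.
have [[xi0E _] _ _ _ _] := alg.
apply: (subdiff_inj Rf_proper sigma_gt0 Rf_sc _ x0_subdiff).
by rewrite -xi0E; exact: iterate_subdiff.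
Qed.

Lemma bregr_near v u : subdiff ipX Rf u v -> edom Rf xb ->
  bregr ipX Rf v xb u <= sigma * rho ^+ 2 -> `|xb - u| <= rho.
Proof.
move=> vu bD h; have := le_trans (subdiff_bregr_ge Rf_proper sigma_gt0 Rf_sc vu bD) h.
by rewrite ler_pM2l // ler_pXn2r // nnegrE // ltW.
Qed.

Lemma reference_ball : B xb.
Proof.
rewrite ball_B /cball /=; have := bregr_near x0_subdiff xb_edom xb_near; have := rho_gt0; lra.
Qed.

(** Proved jointly with [D xb n] <= sigma rho^2, since descent needs the first and preserves the
    second; x_n and x0 then both lie within rho of xb. *)
Lemma iterate_ball n : B (x n).
Proof.
have xbs : solution xb by split=> //; exact: reference_ball.
suff [Bn _] : (forall i, (i <= n)%N -> B (x i)) /\ D xb n <= sigma * rho ^+ 2 by exact: Bn.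
have near_ball k : D xb k <= sigma * rho ^+ 2 -> B (x k).
  move=> /(bregr_near (iterate_subdiff k) xb_edom) near_k.
  rewrite ball_B /cball /=; have := bregr_near x0_subdiff xb_edom xb_near.
  rewrite distrC in near_k => ?; have := ler_distD xb (x k) x0. lra.
elim: n => [|n [Bn Dn]].
  have D0 : D xb 0 <= sigma * rho ^+ 2.
    by rewrite /D iterate0; have [[-> _] _ _ _ _] := alg.
  by split=> // i; rewrite leqn0 => /eqP->; exact: near_ball.
have DS : D xb n.+1 <= sigma * rho ^+ 2.
  apply: le_trans Dn; apply: le_trans (descent xbs Bn) _.
  have [/andP[a0 _] _ _] := stepsize_iterate (Bn n (leqnn n)).
  by rewrite gerBl mulr_ge0 ?mulr_ge0 ?exprn_ge0 // ltW // descent_const_gt0.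
split=> // i; rewrite leq_eqVlt => /predU1P[->|]; first exact: near_ball.
exact: Bn.
Qed.

Lemma bregman_descent n z : solution z -> D z n.+1 <= D z n - c * (alpha n * `|r n| ^+ 2).
Proof. by move=> zs; apply: descent => // i _; exact: iterate_ball. Qed.

Lemma bregman_nonincreasing n z : solution z -> D z n.+1 <= D z n.
Proof.
move=> zs; apply: le_trans (bregman_descent n zs) _.
have [/andP[a0 _] _ _] := stepsize_iterate (iterate_ball n).
by rewrite gerBl mulr_ge0 ?mulr_ge0 ?exprn_ge0 // ltW // descent_const_gt0.
Qed.

(* The discounted sums of squared residuals, which control the momentum terms;
   the initial [+ 1] keeps them positive even when residuals vanish, so that
   record lows occur at arbitrarily large indices. *)
Fixpoint weight n : R :=
  match n with
  | 0 => `|r 0%N| ^+ 2 + 1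
  | k.+1 => `|r k.+1| ^+ 2 + beta * weight k
  end.

Lemma weight_gt0 n : 0 < weight n.
Proof.
have /andP[b0 _] := beta01.
by elim: n => [|n IH] /=; rewrite ltr_wpDl ?exprn_ge0 // mulr_gt0.
Qed.

Lemma residual_le_weight n : `|r n| ^+ 2 <= weight n.
Proof.
have /andP[b0 _] := beta01.
by case: n => [|n] /=; rewrite lerDl // mulr_ge0 // ltW // weight_gt0.
Qed.

Let a0 := Num.min (mu0 / Lc ^+ 2) mu1.

Lemma stepsize_lower_gt0 : 0 < a0.
Proof. by rewrite lt_min mu1_gt0 andbT divr_gt0 ?exprn_gt0 //; case/andP: mu0_bnd. Qed.

(* Summing the recursion of [weight] and the descent inequality exhibits
   [weight n] as at most a decrement of this nonnegative quantity. *)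
Let tail n := (weight n + D xb n.+1 / (c * a0)) / (1 - beta).

Lemma weight_le_tail n : weight n <= tail n - tail n.+1.
Proof.
have xbs : solution xb by split=> //; exact: reference_ball.
have b1 : 0 < 1 - beta by rewrite subr_gt0; case/andP: beta01.
have ca0 : 0 < c * a0 by rewrite mulr_gt0 ?descent_const_gt0 ?stepsize_lower_gt0.
rewrite /tail -mulrBl ler_pdivlMr //=.
(* This squared residual cancels the one in [weight n.+1], leaving (1 - beta) [weight n]. *)
have : `|r n.+1| ^+ 2 <= D xb n.+1 / (c * a0) - D xb n.+2 / (c * a0).
  rewrite -mulrBl ler_pdivlMr // mulrC -mulrA.
  have [_ _ h] := stepsize_iterate (iterate_ball n.+1).
  have := bregman_descent n.+1 xbs.
  by have := ler_wpM2l (ltW descent_const_gt0) h; rewrite -/a0; lra.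
lra.
Qed.

Lemma tail_ge0 n : 0 <= tail n.
Proof.
have b1 : 0 < 1 - beta by rewrite subr_gt0; case/andP: beta01.
have ca0 : 0 < c * a0 by rewrite mulr_gt0 ?descent_const_gt0 ?stepsize_lower_gt0.
rewrite divr_ge0 ?(ltW b1) // addr_ge0 ?(ltW (weight_gt0 n)) // divr_ge0 ?(ltW ca0) //.
exact: subdiff_bregr_ge0 (iterate_subdiff _) xb_edom.
Qed.

(** The decrements of the nonincreasing nonnegative [tail] tend to 0. *)
Lemma weight_cvg0 : weight @ \oo --> (0 : R).
Proof.
apply/cvgrPdist_le => e e0.
have tailS n : tail n.+1 <= tail n.
  by rewrite -subr_ge0; apply: le_trans (weight_le_tail n); exact/ltW/weight_gt0.
have [N tN] := nonincreasing_ge0_cauchy tailS tail_ge0 e0.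
exists N => // n /= Nn; rewrite sub0r normrN ger0_norm ?(ltW (weight_gt0 n)) //.
exact: le_trans (weight_le_tail n) (tN _ _ Nn).
Qed.

Lemma residual_cvg0 : (fun n => F (x n)) @ \oo --> y.
Proof.
apply/cvgrPdist_le => e e0.
have [N _ wN] := (cvgrPdist_le _ _).1 weight_cvg0 (e ^+ 2) (exprn_gt0 2 e0).
exists N => // n /= Nn; have := wN n Nn.
rewrite sub0r normrN ger0_norm ?(ltW (weight_gt0 n)) // => /(le_trans (residual_le_weight n)).
by rewrite ler_pXn2r ?nnegrE ?(ltW e0) // distrC.
Qed.

(** * Momentum terms tested at record-low iterates *)

Let A := mu0 / Lc ^+ 2 + mu1.
(** A bounds the step sizes; 2 and 3 come from [gradient_product], the inverse of 1 - beta from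
    [discounted_bound]. *)
Let C := 2 * A * (3 + (1 - beta)^-1).

(** Triangle inequality in the cone condition, with 1 + eta <= 2. *)
Lemma Lop_increment u v : B u -> B v -> `|Lop v (u - v)| <= 2 * `|F u - F v|.
Proof.
move=> Bu Bv; have := tcc Bu Bv; have /andP[_ eta1] := eta01.
have := ler_normB (F u - F v) (F u - F v - Lop v (u - v)); rewrite subKr.
have := normr_ge0 (F u - F v); nra.
Qed.

(** Passing through x_n splits x_q - z into increments controlled by |r_q| + |r_n| and |r_n|; the
    product |r_q| |r_n| is split into squares, and |r_q|^2 <= [weight q]. *)
Lemma gradient_product n q z : solution z ->
  `|ipX (g n) (x q - z)| <= 2 * (3 * `|r n| ^+ 2 + weight q).
Proof.
move=> [Bz _ Fz].
have -> : x q - z = (x q - x n) - (z - x n) by rewrite opprB addrA subrK.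
have Bn := iterate_ball n.
rewrite ipDr ipNr !(ip_sym ipX (g n)) -!(LopK Bn) -/(r n).
apply: le_trans (ler_normB _ _) _.
have hq := Lop_increment (iterate_ball q) (iterate_ball n).
have hz := Lop_increment Bz (iterate_ball n).
have cq := ip_cauchy_schwarz ipY (Lop (x n) (x q - x n)) (r n).
have cz := ip_cauchy_schwarz ipY (Lop (x n) (z - x n)) (r n).
have rz : `|F z - F (x n)| = `|r n| by rewrite Fz distrC.
have rq : `|F (x q) - F (x n)| <= `|r q| + `|r n|.
  have -> : F (x q) - F (x n) = r q - r n by rewrite /r opprB addrA subrK.
  exact: ler_normB.
have := residual_le_weight q; rewrite rz in hz.
move: (normr_ge0 (r n)) (normr_ge0 (r q)) => rn0 rq0 wq.
have sq : 0 <= (`|r q| - `|r n|) ^+ 2 by exact: sqr_ge0.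
have := ler_wpM2r rn0 hz; have := ler_wpM2r rn0 hq; have := ler_wpM2r rn0 rq.
nra.
Qed.

Lemma momentum_product n q z : solution z -> record_low weight q -> (n <= q)%N ->
  `|ipX (m n.+1) (x q - z)| <= C * weight n.
Proof.
move=> zs rec_q nq; have /andP[b0 b1] := beta01.
have A0 : 0 <= A.
  have [/andP[a_ge0 a_le] _ _] := stepsize_iterate (iterate_ball 0); exact: le_trans a_le.
(* Here d = [weight q]; the record-low property supplies d <= [weight n] for n <= q. *)
apply: (@discounted_bound _ (fun n => `|ipX (m n) (x q - z)|) weight
  (fun n => `|r n| ^+ 2) beta 3 (weight q) (2 * A) q) => //.
- by rewrite (ltW b0).
- by rewrite mulr_ge0.
- exact/ltW/weight_gt0.
- by rewrite ip0l normr0.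
- by rewrite lerDl.
move=> k kq; rewrite momentumS ipDl ipNl !ipZl.
have [/andP[a_ge0 a_le] _ _] := stepsize_iterate (iterate_ball k).
have [/andP[bk0 bk] _] := momentum_weight k.
apply: le_trans (ler_normD _ _) _; rewrite normrN !normrM (ger0_norm a_ge0) (ger0_norm bk0).
apply: lerD; last exact: ler_wpM2r.
apply: le_trans (ler_wpM2l a_ge0 (gradient_product k q zs)) _.
rewrite -mulrA mulrCA ler_wpM2l // ler_wpM2r // addr_ge0 ?mulr_ge0 ?exprn_ge0 //.
exact/ltW/weight_gt0.
Qed.

Lemma momentum_const_ge0 : 0 <= C.
Proof.
have /andP[b0 b1] := beta01.
have A0 : 0 <= A.
  have [/andP[a_ge0 a_le] _ _] := stepsize_iterate (iterate_ball 0); exact: le_trans a_le.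
by rewrite /C !mulr_ge0 // addr_ge0 // invr_ge0 subr_ge0 ltW.
Qed.

Lemma bregman_record p q z : solution z -> record_low weight q -> (p <= q)%N ->
  bregr ipX Rf (xi p) (x q) (x p) <= D z p - D z q + C * (tail p - tail q).
Proof.
move=> zs rec_q pq.
(* The difference of dual iterates telescopes into momenta, each contributing at most C [weight n],
   hence at most C times a decrement of [tail]. *)
have step n : (p <= n <= q)%N -> ipX (xi n - xi p) (x q - z) <= C * (tail p - tail n).
  elim: n => [|n IH].
    by rewrite leqn0 => /andP[/eqP-> _]; rewrite !subrr ip0l mulr0.
  rewrite leq_eqVlt => /andP[/predU1P[->|pn nq]]; first by rewrite !subrr ip0l mulr0.
  have -> : xi n.+1 - xi p = m n.+1 + (xi n - xi p) by rewrite /= addrA subrK.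
  rewrite ipDl; have := IH; rewrite -ltnS pn ltnW // => /(_ isT).
  have := le_trans (ler_norm _) (momentum_product zs rec_q (ltnW nq)).
  by have := ler_wpM2l momentum_const_ge0 (weight_le_tail n); lra.
have := step q; rewrite pq leqnn => /(_ isT).
rewrite /D (bregr_three_points ipX Rf (xi q) (xi p) z (x q)) !ipBl; lra.
Qed.

(** For z = xb the bound of [bregman_record] is a decrement of one nonincreasing nonnegative
    sequence V. Only q must be a record low; p is any index from N to q. *)
Lemma bregman_record_small (e : R) : 0 < e -> exists N, forall p q,
  (N <= p <= q)%N -> record_low weight q -> bregr ipX Rf (xi p) (x q) (x p) <= e.
Proof.
move=> e0; have xbs : solution xb by split=> //; exact: reference_ball.
pose V n := D xb n + C * tail n.
have VS n : V n.+1 <= V n.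
  apply: lerD; first exact: bregman_nonincreasing.
  rewrite ler_wpM2l ?momentum_const_ge0 // -subr_ge0.
  by apply: le_trans (weight_le_tail n); exact/ltW/weight_gt0.
have V0 n : 0 <= V n.
  apply: addr_ge0; last exact: mulr_ge0 momentum_const_ge0 (tail_ge0 n).
  exact: subdiff_bregr_ge0 (iterate_subdiff _) xb_edom.
have [N VN] := nonincreasing_ge0_cauchy VS V0 e0.
exists N => p q /andP[Np pq] rec_q.
apply: le_trans (bregman_record xbs rec_q pq) _.
by have := VN p q Np; rewrite /V; lra.
Qed.

(** * Passage to the limit along record lows *)

Context (domF : set X) (B_domF : B `<=` domF).
Context (Rf_lsc : lower_semicontinuous Rf).
Context (F_closed : forall (u : nat -> X) z v, (forall n, domF (u n)) ->
  weak_cvg ipX u z -> (fun n => F (u n)) @ \oo --> v -> domF z /\ F z = v).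

Lemma exists_limit_solution : exists xs, [/\ domF xs, solution xs
  & forall e, 0 < e -> exists N, forall n, (N <= n)%N -> D xs n <= e].
Proof.
have [phi phiP] : {phi : nat -> nat & forall j, (j <= phi j)%N /\ record_low weight (phi j)}.
  apply: (@boolp.choice _ _ (fun j k => (j <= k)%N /\ record_low weight k)) => j.
  by have [k jk reck] := record_low_unbounded weight_gt0 weight_cvg0 j; exists k.
have phi_ge j : (j <= phi j)%N := (phiP j).1.
have phi_rec j : record_low weight (phi j) := (phiP j).2.
pose u j := x (phi j).
have phi_cvg (N : nat) : \forall j \near \oo, (N <= phi j)%N.
  by exists N => // j /= Nj; exact: leq_trans (phi_ge j).
have u_cauchy : cauchy (u @ \oo).
  apply: cauchy_exP => e e0.
  (* At this level strong convexity gives a distance of at most e / 2, strictly below e. *)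
  have e2 : 0 < sigma * (e / 2) ^+ 2 by rewrite mulr_gt0 // exprn_gt0 // divr_gt0.
  have [N hN] := bregman_record_small e2.
  exists (u N); suff : \forall j \near \oo, ball (u N) e (u j) by [].
  apply: filterS (phi_cvg (phi N)) => j Nj; rewrite -ball_normE /= distrC.
  have := hN (phi N) (phi j); rewrite phi_ge Nj => /(_ isT (phi_rec j)).
  have j_edom := (iterate_subdiff (phi j)).1.
  move=> /(le_trans (subdiff_bregr_ge Rf_proper sigma_gt0 Rf_sc (iterate_subdiff _) j_edom)).
  rewrite ler_pM2l // ler_pXn2r ?nnegrE ?divr_ge0 ?(ltW e0) // => /le_lt_trans; apply; lra.
have /cvg_ex[xs u_xs] : cvg (u @ \oo) by exact/cauchy_cvgP.
have F_u : (fun j => F (u j)) @ \oo --> y.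
  apply: (cvg_comp phi (fun n => F (x n)) _ residual_cvg0).
  by move=> S [N _ NS]; apply: filterS (phi_cvg N) => j; exact: NS.
have [xs_dom Fxs] : domF xs /\ F xs = y.
  apply: F_closed F_u; first by move=> j; apply: B_domF; exact: iterate_ball.
  by move=> v; exact: cvg_ipr.
have Bxs : B xs.
  rewrite ball_B /cball /=; apply/ler_addgt0Pr => e e0.
  have [j _ uj] := (cvgrPdist_le _ _).1 u_xs e e0.
  have := uj j (leqnn j); have := iterate_ball (phi j); rewrite ball_B /cball /= -/(u j).
  have := ler_distD (u j) xs x0; lra.
(* Stated in the extended reals, since finiteness of [Rf xs] is only deduced afterwards, from the
   case e = 1. *)
have D_xs (e : R) : 0 < e -> exists N, forall p, (N <= p)%N ->
    (Rf xs <= (fine (Rf (x p)) + ipX (xi p) (xs - x p) + e)%:E)%E.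
  move=> e0; have [N hN] := bregman_record_small e0; exists N => p Np.
  apply: (lower_semicontinuous_le_cvg (b := fun j =>
    fine (Rf (x p)) + ipX (xi p) (u j - x p) + e) Rf_lsc u_xs).
    apply: cvgD; last exact: cvg_cst.
    apply: cvgD; first exact: cvg_cst.
    by apply: cvg_ipr; apply: cvgB => //; exact: cvg_cst.
  apply: filterS (phi_cvg p) => j pj.
  rewrite -(edom_fineK Rf_proper (iterate_subdiff (phi j)).1) lee_fin.
  have := hN p (phi j); rewrite Np pj => /(_ isT (phi_rec j)).
  by rewrite /bregr -/(u j); lra.
have xs_edom : edom Rf xs.
  have [N hN] := D_xs 1 ltr01.
  by apply: le_lt_trans (hN N (leqnn N)) _; exact: ltry.
exists xs; split => // e /D_xs[N hN]; exists N => n /hN.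
by rewrite -(edom_fineK Rf_proper xs_edom) lee_fin /D /bregr; lra.
Qed.

(** Each momentum combines vectors in the ranges of the adjoints at the iterates, and these are
    orthogonal to h. *)
Lemma dual_increment_orthogonal h n :
  (forall z, B z -> Lop z h = 0) -> ipX (xi n - xi0) h = 0.
Proof.
move=> Lh; have [[xi0E _] _ _ _ _] := alg.
suff [//] : ipX (xi n - xi0) h = 0 /\ ipX (m n) h = 0.
elim: n => [|n [xin mn]]; first by rewrite xi0E subrr ip0l.
have mS : ipX (m n.+1) h = 0.
  rewrite momentumS ipDl ipNl !ipZl mn mulr0 addr0 ip_sym -LopK; last exact: iterate_ball.
  by rewrite Lh ?ip0l ?mulr0 ?oppr0 //; exact: iterate_ball.
split=> //; have -> : xi n.+1 - xi0 = m n.+1 + (xi n - xi0) by rewrite /= addrA subrK.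
by rewrite ipDl mS xin addr0.
Qed.

End Iteration.

(** * Convergence of the whole sequence and identification of the limit *)

Theorem mainTheorem7 (R : realType) (X Y : completeNormedModType R)
  (ipX : inner_product X) (ipY : inner_product Y)
  (Rf : X -> \bar R) (sigma : R)
  (F : X -> Y) (domF : set X) (y : Y)
  (Lop : X -> X -> Y) (Ladj : X -> Y -> X) (gradRs : X -> X)
  (rho : R) (x0 xi0 : X) (eta Lc beta mu0 mu1 : R) (adaptive : bool)
  (xi x : nat -> X) (alpha betan gamma : nat -> R) :
  (* R proper, lsc, sigma-strongly convex *)
  proper_fun Rf -> lower_semicontinuous Rf -> 0 < sigma ->
  strongly_convex Rf sigma ->
  (* gradRs xi = ∇R*(xi) = argmin_x { R(x) - <xi, x> } *)
  (forall (v z : X), (Rf (gradRs v) - (ipX v (gradRs v))%:E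
                      <= Rf z - (ipX v z)%:E)%E) ->
  (* assumption (b) *)
  0 < rho -> subdiff ipX Rf x0 xi0 -> cball x0 (2 * rho) `<=` domF ->
  (exists xb, domF xb /\ F xb = y /\
     (bregman ipX Rf xi0 xb x0 <= (sigma * rho ^+ 2)%:E)%E) ->
  (* assumption (c): weak closedness *)
  (forall (u : nat -> X) (z : X) (v : Y), (forall n, domF (u n)) ->
     weak_cvg ipX u z -> (fun n => F (u n)) @ \oo --> v -> domF z /\ F z = v) ->
  (* assumption (d) *)
  (forall z, cball x0 (2 * rho) z ->
     forall (a : R) (h k : X), Lop z (a *: h + k) = a *: Lop z h + Lop z k) ->
  (forall z, cball x0 (2 * rho) z -> forall (h : X) (r : Y),
     ipY (Lop z h) r = ipX h (Ladj z r)) ->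
  (forall z, cball x0 (2 * rho) z -> forall e : R, 0 < e ->
     exists2 d : R, 0 < d & forall z', cball x0 (2 * rho) z' -> `|z' - z| < d ->
       forall h : X, `|Lop z' h - Lop z h| <= e * `|h|) ->
  0 <= eta < 1 ->
  (forall z zb, cball x0 (2 * rho) z -> cball x0 (2 * rho) zb ->
     `|F z - F zb - Lop zb (z - zb)| <= eta * `|F z - F zb|) ->
  0 < Lc ->
  (forall z, cball x0 (2 * rho) z -> forall h : X, `|Lop z h| <= Lc * `|h|) ->
  (* parameters and the algorithm *)
  0 < mu0 < 4 * sigma * (1 - eta) -> 0 < beta < 1 -> 0 < mu1 ->
  Algorithm2 ipX ipY F y Ladj gradRs eta Lc beta mu0 mu1 sigma adaptive xi0
    xi x alpha betan gamma ->
  exists xs : X,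
    [/\ domF xs /\ F xs = y,
        cball x0 (2 * rho) xs /\ edom Rf xs,
        (fun n => bregman ipX Rf (xi n) xs (x n)) @ \oo --> 0%:E,
        (fun n => `|x n - xs|) @ \oo --> (0 : R)
      & forall xdag : X,
          domF xdag -> F xdag = y ->
          (forall z, domF z -> F z = y ->
             (bregman ipX Rf xi0 xdag x0 <= bregman ipX Rf xi0 z x0)%E) ->
          (forall z, cball x0 (2 * rho) z ->
             forall h : X, Lop xdag h = 0 -> Lop z h = 0) ->
          xs = xdag].
Proof.
move=> Rf_proper Rf_lsc s0 Rf_sc argmin rho0 x0_sub B_dom [xb [xb_dom [xb_sol xb_near]]].
move=> F_closed _ LopK _ eta01 tcc Lc0 Lop_le mu0_bnd beta01 mu10 alg.
have breg_dom z : (bregman ipX Rf xi0 z x0 <= (sigma * rho ^+ 2)%:E)%E ->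
    edom Rf z /\ bregr ipX Rf xi0 z x0 <= sigma * rho ^+ 2.
  move=> h; have zD := bregman_fin_edom Rf_proper x0_sub.1 h.
  by split=> //; move: h; rewrite bregmanE ?lee_fin //; exact: x0_sub.1.
have [xb_edom xb_bregr] := breg_dom xb xb_near.
have x_sub n : subdiff ipX Rf (x n) (xi n) := iterate_subdiff Rf_proper argmin alg n.
have [xs [xs_dom [Bxs xs_edom Fxs] D_small]] :=
  exists_limit_solution Rf_proper s0 Rf_sc argmin LopK eta01 tcc Lc0 Lop_le mu0_bnd beta01
    mu10 alg erefl rho0 x0_sub xb_sol xb_edom xb_bregr B_dom Rf_lsc F_closed.
have D_ge0 n : 0 <= bregr ipX Rf (xi n) xs (x n) by exact: subdiff_bregr_ge0 (x_sub n) _.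
(* Used twice: for xs itself and, under the kernel condition, for xdag. *)
have x_cvg z : edom Rf z ->
    (forall n, bregr ipX Rf (xi n) z (x n) <= bregr ipX Rf (xi n) xs (x n)) ->
    x @ \oo --> z.
  move=> zD z_le; apply/cvgrPdist_le => e e0.
  have [N hN] := D_small (sigma * e ^+ 2) (mulr_gt0 s0 (exprn_gt0 2 e0)).
  exists N => // n /= /hN /(le_trans (z_le n)).
  move=> /(le_trans (subdiff_bregr_ge Rf_proper s0 Rf_sc (x_sub n) zD)).
  by rewrite ler_pM2l // ler_pXn2r // nnegrE // ltW.
have x_xs : x @ \oo --> xs by exact: x_cvg.
exists xs; split=> //.
- have -> : (fun n => bregman ipX Rf (xi n) xs (x n)) =
      EFin \o (fun n => bregr ipX Rf (xi n) xs (x n)).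
    by apply/funext => n /=; rewrite bregmanE //; exact: (x_sub n).1.
  apply: cvg_EFin; first by near=> n.
  apply/cvgrPdist_le => e /D_small[N hN].
  by exists N => // n /= /hN; rewrite sub0r normrN ger0_norm.
- apply/cvgrPdist_le => e e0; move/cvgrPdist_le : x_xs => /(_ e e0).
  by apply: filterS => n; rewrite sub0r normrN normr_id distrC.
move=> xdag xdag_dom Fxdag xdag_min ker.
(* Minimality against xb bounds the distance of xdag by sigma rho^2, which places it in the ball. *)
have [xdag_edom xdag_bregr] := breg_dom xdag (le_trans (xdag_min xb xb_dom xb_sol) xb_near).
have Bxdag : cball x0 (2 * rho) xdag.
  have := le_trans (subdiff_bregr_ge Rf_proper s0 Rf_sc x0_sub xdag_edom) xdag_bregr.
  rewrite ler_pM2l // ler_pXn2r ?nnegrE ?(ltW rho0) // /cball /=; lra.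
(* Both points are solutions, so the right side of the cone condition vanishes. *)
have Lop0 : Lop xdag (xs - xdag) = 0.
  have := tcc xs xdag Bxs Bxdag.
  by rewrite Fxs Fxdag subrr normr0 mulr0 sub0r normrN normr_le0 => /eqP.
have orth n : ipX (xi n - xi0) (xs - xdag) = 0.
  apply: (dual_increment_orthogonal Rf_proper s0 Rf_sc argmin LopK tcc Lc0 Lop_le mu0_bnd
    beta01 mu10 alg erefl rho0 x0_sub xb_sol xb_edom xb_bregr) => z Bz; exact: ker.
suff x_xdag : x @ \oo --> xdag by exact: cvg_unique x_xs x_xdag.
apply: x_cvg => // n.
(* By [orth], comparing the distances at xi_n reduces to comparing them at xi0, where xdag is
   minimal. *)
have := xdag_min xs xs_dom Fxs; rewrite !bregmanE ?lee_fin //; try exact: x0_sub.1.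
have := orth n; rewrite /bregr ipBl !ipBr; lra.
Unshelve. all: by end_near. Qed.
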